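(* Let $G=(V,E,\omega)$ be a weighted directed graph with $V=\{1,\dots,N\}$ and adjacency matrix $A\in\mathbb R_+^{N\times N}$, and let $\tilde G$ be the graph on $V$, with adjacency matrix $\tilde A\in\mathbb R_+^{N\times N}$, obtained from $G$ by adding, erasing, or modifying the weights of the edges contained in a set $\delta E\subset V\times V$. Let $S=\{s : (s,t)\in\delta E\}$, $T=\{t : (s,t)\in\delta E\}$, let $k,\ell\in V$ and $\delta=d_G(k,S)+d_G(T,\ell)$. Let $\Omega\subset\mathbb C$ be a set containing $\mathcal F(A)$ and $\mathcal F(\tilde A)$. If the boundary of $\Omega$ is a horizontal ellipse with semi-axes $a\ge b>0$ and center $c$, and $\delta>b-1$, then $$\left|\left(\exp(A)-\exp(\tilde A)\right)_{k\ell}\right|\le \frac{4e^{\Re(c)}\,p(\delta+1)}{p(\delta+1)-(a+b)/(\delta+1)}\left(\frac{a+b}{\delta+1}\,\frac{e^{q(\delta+1)}}{p(\delta+1)}\right)^{\delta+1},$$ with $q(t)=1+\frac{a^2-b^2}{t^2+t\sqrt{t^2+a^2-b^2}}$ and $p(t)=1+\sqrt{1+(a^2-b^2)/t^2}$. Moreover: 1. If $\Omega$ is a disk of radius $a$ and center $c$, and $\delta>a-1$, then $$\left|\left(\exp(A)-\exp(\tilde A)\right)_{k\ell}\right|\le 4e^{\Re(c)}\,\frac{\delta+1}{\delta+1-a}\left(\frac{ae}{\delta+1}\right)^{\delta+1}.$$ 2. If $\Omega$ is a real interval $[c-a,c+a]$ with $a>0$, then for every $\delta>0$ $$\left|\left(\exp(A)-\exp(\tilde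 A)\right)_{k\ell}\right|\le \frac{4e^{c}\,p(\delta+1)}{p(\delta+1)-a/(\delta+1)}\left(\frac{a}{\delta+1}\,\frac{e^{q(\delta+1)}}{p(\delta+1)}\right)^{\delta+1},$$ with $q(t)=1+\frac{a^2}{t^2+t\sqrt{t^2+a^2}}$ and $p(t)=1+\sqrt{1+(a/t)^2}$.
   Context: A weighted directed graph $G=(V,E,\omega)$ has edge set $E\subseteq V\times V$ and weights $\omega:E\to(0,\infty)$; its adjacency matrix has entries $a_{ij}=\omega(ij)$ if $(i,j)\in E$ and $a_{ij}=0$ otherwise (undirected graphs are the case of symmetric $A$). $d_G(k,\ell)$ is the length (number of edges) of a shortest walk from $k$ to $\ell$ in $G$, with $d_G(k,k)=0$ and $d_G(k,\ell)=+\infty$ if no walk exists; $d_G(k,S)=\min_{s\in S}d_G(k,s)$ and $d_G(T,\ell)=\min_{t\in T}d_G(t,\ell)$. If $\delta=+\infty$ the right-hand sides are read as $0$. The field of values of $A\in\mathbb C^{N\times N}$ is $\mathcal F(A)=\{x^*Ax : x\in\mathbb C^N,\ \|x\|_2=1\}$. ''The boundary of $\Omega$ is a horizontal ellipse'' means that $\Omega$ is the closed region bounded by an ellipse whose semi-axis of length $a$ is parallel to the real axis and whose semi-axis of length $b$ is parallel to the imaginary axis. Disks are closed. $\Re$ denotes the real part. *)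

(* Defs.v *)
From mathcomp Require Import all_boot all_order all_algebra.
From mathcomp Require Import complex.
From mathcomp Require Import all_classical all_reals all_analysis.

Set Implicit Arguments.
Unset Strict Implicit.
Unset Printing Implicit Defensive.

Import Order.TTheory GRing.Theory Num.Theory.
Import numFieldNormedType.Exports.

Local Open Scope classical_set_scope.
Local Open Scope ring_scope.

(* Vertices are ['I_N]; [weight] is only meaningful on [edges]. *)
Record wdigraph (R : realType) (N : nat) := WDigraph {
  edges : {set 'I_N * 'I_N};
  weight : 'I_N * 'I_N -> R;
  weight_gt0 : forall e, e \in edges -> 0 < weight e
}.

Definition adjacency (R : realType) (N : nat) (G : wdigraph R N) : 'M[R]_N :=
  \matrix_(i, j) if (i, j) \in edges G then weight G (i, j) else 0.

(* [H] arises from [G] by adding, erasing or reweighting edges in [dE] only;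
   an edge of [dE] is allowed to be left unchanged. *)
Definition modified_within (R : realType) (N : nat) (G H : wdigraph R N)
    (dE : {set 'I_N * 'I_N}) : Prop :=
  forall e, e \notin dE ->
    ((e \in edges G) = (e \in edges H)) /\
    (e \in edges G -> weight G e = weight H e).

Definition walk (R : realType) (N : nat) (G : wdigraph R N)
    (k l : 'I_N) (p : seq 'I_N) : Prop :=
  path (fun i j => (i, j) \in edges G) k p /\ last k p = l.

(* The infimum of the empty set is [+oo]; otherwise this is a minimum, being
   the infimum of a nonempty set of natural numbers. *)
Definition dist (R : realType) (N : nat) (G : wdigraph R N)
    (k l : 'I_N) : \bar R :=
  ereal_inf [set ((size p)%:R : R)%:E | p in [set p | walk G k l p]].

Definition dist_to_set (R : realType) (N : nat) (G : wdigraph R N)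
    (k : 'I_N) (S : {set 'I_N}) : \bar R :=
  \big[Order.min/+oo%E]_(s in S) dist G k s.

Definition dist_from_set (R : realType) (N : nat) (G : wdigraph R N)
    (T : {set 'I_N}) (l : 'I_N) : \bar R :=
  \big[Order.min/+oo%E]_(t in T) dist G t l.

Definition sources (N : nat) (dE : {set 'I_N * 'I_N}) : {set 'I_N} :=
  [set e.1 | e in dE]%SET.

Definition targets (N : nat) (dE : {set 'I_N * 'I_N}) : {set 'I_N} :=
  [set e.2 | e in dE]%SET.

Definition expmx (R : realType) (N : nat) (A : 'M[R]_N) : 'M[R]_N :=
  limn (series (fun n : nat => (n`!%:R)^-1 *: A ^+ n)).

Definition norm2 (R : realType) (N : nat) (x : 'cV[R[i]%C]_N) : R[i]%C :=
  sqrtC (\sum_i `|x i 0| ^+ 2).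

Definition field_of_values (R : realType) (N : nat) (A : 'M[R[i]%C]_N) :
    set (R[i]%C) :=
  [set ((map_mx Num.conj x)^T *m A *m x) 0 0 | x in [set x | norm2 x = 1]].

Definition complexify (R : realType) (N : nat) (A : 'M[R]_N) : 'M[R[i]%C]_N :=
  map_mx (real_complex R) A.

Definition elliptic_region (R : realType) (a b : R) (c : R[i]%C) :
    set (R[i]%C) :=
  [set z | ((complex.Re z - complex.Re c) / a) ^+ 2
         + ((complex.Im z - complex.Im c) / b) ^+ 2 <= 1].

Definition closed_disk (R : realType) (a : R) (c : R[i]%C) : set (R[i]%C) :=
  [set z | `|z - c| <= real_complex R a].

Definition real_interval (R : realType) (x y : R) : set (R[i]%C) :=
  [set real_complex R t | t in `[x, y]].

(* Value at [d] of a bound given for finite distances, read as 0 when the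
   distance is infinite. *)
Definition bound_at (R : realType) (f : R -> R) (d : \bar R) : R :=
  if d is r%:E then f r else 0.

Definition p_ellipse (R : realType) (a b t : R) : R :=
  1 + Num.sqrt (1 + (a ^+ 2 - b ^+ 2) / t ^+ 2).

Definition q_ellipse (R : realType) (a b t : R) : R :=
  1 + (a ^+ 2 - b ^+ 2) / (t ^+ 2 + t * Num.sqrt (t ^+ 2 + a ^+ 2 - b ^+ 2)).

Definition p_interval (R : realType) (a t : R) : R :=
  1 + Num.sqrt (1 + (a / t) ^+ 2).

Definition q_interval (R : realType) (a t : R) : R :=
  1 + a ^+ 2 / (t ^+ 2 + t * Num.sqrt (t ^+ 2 + a ^+ 2)).

Definition ellipse_bound (R : realType) (a b : R) (c : R[i]%C) (d : R) : R :=
  4 * expR (complex.Re c) * p_ellipse a b (d + 1)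
    / (p_ellipse a b (d + 1) - (a + b) / (d + 1))
  * ((a + b) / (d + 1)
     * (expR (q_ellipse a b (d + 1)) / p_ellipse a b (d + 1))) `^ (d + 1).

Definition disk_bound (R : realType) (a : R) (c : R[i]%C) (d : R) : R :=
  4 * expR (complex.Re c) * ((d + 1) / (d + 1 - a))
  * (a * expR 1 / (d + 1)) `^ (d + 1).

Definition interval_bound (R : realType) (a c d : R) : R :=
  4 * expR c * p_interval a (d + 1)
    / (p_interval a (d + 1) - a / (d + 1))
  * (a / (d + 1)
     * (expR (q_interval a (d + 1)) / p_interval a (d + 1))) `^ (d + 1).

(* Main.v *)
Require Import Defs.
From mathcomp Require Import all_boot all_order all_algebra.
From mathcomp Require Import all_solvable all_field.
From mathcomp Require Import complex ring lra.
From mathcomp Require Import all_classical all_reals all_analysis.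
Import Order.TTheory GRing.Theory Num.Theory.
Import numFieldNormedType.Exports.
Local Open Scope classical_set_scope.
Local Open Scope ring_scope.

(** A horizontal ellipse is the image of the unit circle under
    [w |-> c + rho (w + kappa / w)] with [rho = (a + b) / 2] and
    [kappa = (a - b) / (a + b)], so its Faber polynomials are given by
    [F_n (w + kappa / w) = w^n + (kappa / w)^n].  If the ellipse contains the
    field of values of [A] and [B = (A - c) / rho], then the field of values of
    [F_n(B)] lies in the ellipse with semi-axes [1 + kappa^n] and
    [1 - kappa^n]; adding the bounds for the Hermitian and the skew-Hermitian
    part, every entry of [F_n(B)] is at most 2 in modulus.

    Polynomials of degree at most [delta] take the same [(k, l)] entry at the
    two adjacency matrices, since a nonzero difference produces a walk from [k]
    to [S] and a walk from [T] to [l].  Hence the entry of the difference of the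
    [F_n] vanishes for [n <= delta] and is at most 4 otherwise, so for
    [tau >= 1] it is dominated by
    [4 tau^-(delta + 1) F_n (tau + kappa / tau)].  As the recurrence
    [X F_n = F_(n+1) + kappa F_(n-1)] has nonnegative coefficients, the
    domination passes to the monomials, hence to the exponential series: the
    error is at most
    [4 e^c tau^-(delta + 1) e^(rho (tau + kappa / tau))], and one optimizes
    [tau].  Disks are the case [a = b], intervals the limit [b -> 0]. *)

(** * Faber polynomials of an ellipse and their numerical range *)

(** Rescaled Chebyshev polynomials: [2 T_n(x / 2)] for [k = 1]. The value 2 at [n = 0] makes
    [F_n(w + k/w) = w^n + (k/w)^n] hold from the start. *)
Fixpoint faber (R : comNzRingType) (k : R) (n : nat) : {poly R} :=
  if n is n1.+1 then
    if n1 is n2.+1 then 'X * faber R k n1 - k%:P * faber R k n2 else 'X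
  else 2%:R.

Arguments faber {R} k n : simpl never.

Section FaberAlgebra.
Variable R : comNzRingType.
Implicit Types (k u : R) (n : nat).

Lemma faber0 k : faber k 0 = 2%:R. Proof. by []. Qed.
Lemma faber1 k : faber k 1 = 'X. Proof. by []. Qed.
Lemma faberSS k n : faber k n.+2 = 'X * faber k n.+1 - k%:P * faber k n.
Proof. by []. Qed.

(** At [X = w + k/w] this is [(1 - u w)(1 - u k/w)]. It is the denominator [L_u] in [1 + sum_(q >=
    1) u^q F_q = (1 - k u^2) / L_u], the series that [faber_head] truncates. *)
Definition faber_factor k u : {poly R} := 1 + k%:P * u%:P ^+ 2 - u%:P * 'X.

Definition faber_head k u n : {poly R} :=
  1 + \sum_(1 <= q < n) u%:P ^+ q * faber k q.

Definition faber_tail k u n : {poly R} :=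
  (k%:P * u%:P) ^+ n
  + \sum_(1 <= q < n) (k%:P * u%:P) ^+ (n - q) * faber k q.

(** The quotient [(1 - k u^2) P / L_u] for [P = 1 + k^n u^(2n) - u^n F_n]; the tail corrects the
    truncation of the series. *)
Definition faber_cofactor k u n : {poly R} :=
  faber_head k u n - u%:P ^+ n * faber_tail k u n.

Lemma faber_head_telescope k u n :
  faber_factor k u * faber_head k u n.+1 =
  (1 - k%:P * u%:P ^+ 2) - u%:P ^+ n.+1 * faber k n.+1
  + k%:P * u%:P ^+ n.+2 * faber k n.
Proof.
rewrite /faber_head /faber_factor; elim: n => [|n IHn].
  by rewrite big_nil faber0 faber1; ring.
rewrite big_nat_recr//= addrA mulrDr {}IHn faberSS !exprS.
by ring.
Qed.

Lemma faber_tailS k u n :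
  faber_tail k u n.+2 = k%:P * u%:P * (faber k n.+1 + faber_tail k u n.+1).
Proof.
rewrite /faber_tail big_nat_recr//= subSnn expr1 !mulrDr -exprS mulr_sumr.
rewrite [RHS]addrCA [X in _ + X = _]addrC; congr (_ + (_ + _)).
apply: eq_big_nat => q /andP[_ qn]; rewrite mulrA -exprS.
by rewrite subSn // ltnW.
Qed.

Lemma faber_tail_telescope k u n :
  faber_factor k u * faber_tail k u n.+1 =
  k%:P * u%:P * faber k n - k%:P * u%:P ^+ 2 * faber k n.+1
  - (1 - k%:P * u%:P ^+ 2) * (k%:P * u%:P) ^+ n.+1.
Proof.
elim: n => [|n IHn].
  by rewrite /faber_tail big_nil /faber_factor faber0 faber1; ring.
rewrite faber_tailS mulrCA mulrDr {}IHn faberSS !exprS /faber_factor.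
by ring.
Qed.

(** The terms in [F_n] of the two telescoped products cancel, and [1 - k u^2] factors out of the
    rest. *)
Lemma faber_cofactorP k u n :
  faber_factor k u * faber_cofactor k u n.+1 =
  (1 - k%:P * u%:P ^+ 2) *
  (1 + k%:P ^+ n.+1 * (u%:P ^+ n.+1) ^+ 2 - u%:P ^+ n.+1 * faber k n.+1).
Proof.
rewrite /faber_cofactor mulrBr faber_head_telescope
  [faber_factor k u * (_ * _)]mulrCA faber_tail_telescope.
by rewrite exprMn !exprS; ring.
Qed.

End FaberAlgebra.

Arguments faber_factor {R}.
Arguments faber_cofactor {R}.

(** * Roots of unity and their power sums *)

Section RootsOfUnity.
Variable C : numClosedFieldType.

(** [X^n - 1] is separable in characteristic 0, so it has [n] distinct roots, one of which is
    primitive. *)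
Lemma ex_prim_root n : (0 < n)%N -> exists z : C, n.-primitive_root z.
Proof.
move=> n_gt0; have [r] := closed_field_poly_normal ('X^n - 1 : {poly C}).
rewrite (monicP _) ?monicXnsubC // scale1r => Dp.
have rn1 : all n.-unity_root r by apply/allP=> z; rewrite -root_prod_XsubC -Dp.
have sz_r : (n < (size r).+1)%N.
  by rewrite -(size_prod_XsubC r id) -Dp size_XnsubC.
have [|z] := hasP (has_prim_root n_gt0 rn1 _ sz_r); last by exists z.
by rewrite -separable_prod_XsubC -Dp separable_Xn_sub_1 // pnatr_eq0 -lt0n.
Qed.

Lemma ex_nth_roots n (z : C) : (0 < n)%N -> `|z| = 1 ->
  exists w : 'I_n -> C, [/\ forall j, `|w j| = 1, forall j, w j ^+ n = z &
    forall q, (0 < q < n)%N -> \sum_j w j ^+ q = 0].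
Proof.
move=> n_gt0 z1; have [e e_prim] := ex_prim_root n n_gt0.
have norm1 (y : C) : `|y ^+ n| = 1 -> `|y| = 1.
  by move=> /eqP; rewrite normrX pexpr_eq1 // => /eqP.
have r0n : (n.-root z) ^+ n = z by rewrite rootCK.
exists (fun j => n.-root z * e ^+ j).
have wn (j : 'I_n) : (n.-root z * e ^+ j) ^+ n = z.
  by rewrite exprMn r0n -exprM mulnC exprM (prim_expr_order e_prim) expr1n mulr1.
split=> // [j|q /andP[q_gt0 qn]]; first by apply: norm1; rewrite wn.
under eq_bigr do rewrite exprMn -exprM mulnC exprM.
rewrite -mulr_sumr; apply/eqP; rewrite mulf_eq0; apply/orP; right.
(* The geometric sum of the [e^(q j)] vanishes because its product with [e^q - 1 != 0] is
   [e^(q n) - 1 = 0]. *)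
have eq1 : e ^+ q - 1 != 0.
  rewrite subr_eq0 -(prim_order_dvd e_prim); apply/negP => /(dvdn_leq q_gt0).
  by rewrite leqNgt qn.
by rewrite -(mulrI_eq0 _ (lregP eq1)) -subrX1 -exprM mulnC exprM
  (prim_expr_order e_prim) expr1n subrr.
Qed.

End RootsOfUnity.

(** * Numerical range of Faber polynomials of a matrix *)

Section NumericalRange.
Variables (C : numClosedFieldType).

Definition hdot {m} (x y : 'cV[C]_m) : C := ((map_mx Num.conj x)^T *m y) 0 0.

Lemma hdot_suml m (I : finType) (x : I -> 'cV[C]_m) (y : 'cV[C]_m) :
  hdot (\sum_i x i) y = \sum_i hdot (x i) y.
Proof.
by rewrite /hdot raddf_sum raddf_sum mulmx_suml summxE.
Qed.

Lemma hdotZl m a (x y : 'cV[C]_m) : hdot (a *: x) y = a^* * hdot x y.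
Proof. by rewrite /hdot map_mxZ linearZ /= -scalemxAl mxE. Qed.

(** Powers of [u] with exponent strictly between 0 and [n] cancel over the n-th roots of [z]. Only 1
    survives from the head, and only [(k u)^n = k^n z] from the tail. *)
Lemma sum_faber_cofactor (k z : C) n (w : 'I_n -> C) : (0 < n)%N ->
  (forall j, w j ^+ n = z) ->
  (forall q, (0 < q < n)%N -> \sum_j w j ^+ q = 0) ->
  \sum_j faber_cofactor k (w j) n = (n%:R * (1 - k ^+ n * z ^+ 2))%:P.
Proof.
move=> n_gt0 wn wq.
have wqP q : (0 < q < n)%N -> \sum_j (w j)%:P ^+ q = 0 :> {poly C}.
  by move/wq => E; under eq_bigr do rewrite -polyC_exp; rewrite -raddf_sum /= E.
rewrite /faber_cofactor big_split/= sumrN big_split/= sumr_const card_ord.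
rewrite exchange_big /= [X in _ + X - _]big1_seq ?addr0; last first.
  by move=> q /andP[_]; rewrite mem_index_iota => qn; rewrite -mulr_suml wqP ?mul0r.
under eq_bigr do rewrite -polyC_exp wn.
rewrite -mulr_sumr big_split/= exchange_big /=
  [X in z%:P * (_ + X)]big1_seq ?addr0; last first.
  move=> q /andP[_]; rewrite mem_index_iota => /andP[q0 qn].
  rewrite -mulr_suml; under eq_bigr do rewrite exprMn.
  by rewrite -mulr_sumr wqP ?mulr0 ?mul0r // subn_gt0 qn ltn_subrL q0 n_gt0.
under eq_bigr do rewrite exprMn -!polyC_exp wn.
rewrite sumr_const card_ord polyCM polyCB polyCM !polyC_exp polyC_natr.
rewrite -mulr_natr; ring.
Qed.

(* Writing [P = 1 + k^n z^2 - z F_n] and letting [u] run over the n-th roots of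
   [z], every factor [L_u = 1 + k u^2 - u X] divides [P], and the average of
   [(1 - k u^2) P / L_u] is the constant [1 - k^n z^2].  Hence, for
   [x_u := (P / L_u) x], the form of [P] at [x] is a weighted mean of the forms of
   the [L_u] at [x_u].  For [k = 0] this is Pearcy's proof of Berger's power
   inequality. *)
Lemma faber_numerical_range m (B : 'M[C]_m.+1) (k : C) : 0 <= k -> k < 1 ->
  (forall (u : C) x, `|u| = 1 ->
     0 <= 'Re ((1 - k * u^* ^+ 2) *
       hdot x (horner_mx B (faber_factor k u) *m x))) ->
  forall n (z : C) x, (0 < n)%N -> `|z| = 1 ->
    0 <= 'Re ((1 - k ^+ n * z^* ^+ 2) *
      hdot x (horner_mx B (1 + (k ^+ n * z ^+ 2)%:P - z%:P * faber k n) *m x)).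
Proof.
move=> k0 k1 posB n z x n_gt0 z1.
have [w [w1 wn wq]] := ex_nth_roots C n z n_gt0 z1.
have kw j : 1 - k * w j ^+ 2 != 0.
  rewrite subr_eq0 eq_sym; apply/eqP => /(congr1 Num.norm).
  rewrite normrM normrX w1 expr1n mulr1 normr1 ger0_norm // => k_eq1.
  by rewrite k_eq1 ltxx in k1.
pose P := 1 + (k ^+ n * z ^+ 2)%:P - z%:P * faber k n.
rewrite -/P; pose Px := horner_mx B P *m x.
pose y j := (1 - k * w j ^+ 2)^-1 *: (horner_mx B (faber_cofactor k (w j) n) *m x).
have Ly j : horner_mx B (faber_factor k (w j)) *m y j = Px.
  rewrite /y -scalemxAr mulmxA [_ *m horner_mx _ _](_ : _ =
    horner_mx B (faber_factor k (w j) * faber_cofactor k (w j) n)); last first.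
    by rewrite rmorphM.
  rewrite -(prednK n_gt0) faber_cofactorP (prednK n_gt0) -[(w j)%:P ^+ n]polyC_exp wn.
  rewrite (_ : 1 - k%:P * (w j)%:P ^+ 2 = (1 - k * w j ^+ 2)%:P); last first.
    by rewrite polyCB polyCM polyC_exp.
  rewrite mul_polyC horner_mxZ -scalemxAl scalerA mulVf // scale1r /Px /P.
  by rewrite polyCM !polyC_exp.
have sum_y : \sum_j (1 - k * w j ^+ 2) *: y j = (n%:R * (1 - k ^+ n * z ^+ 2)) *: x.
  under eq_bigr do rewrite scalerA divff // scale1r.
  by rewrite -mulmx_suml -raddf_sum (sum_faber_cofactor _ z) //= horner_mx_C mul_scalar_mx.
have conjk : k^* = k by apply: CrealP; apply: ger0_real.
(* Each factor sends its [y j] to the same [Px], so the sum can be formed in the first argument,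
   where [sum_y] yields a multiple of [x]; scalars leave that argument conjugated. *)
have key : n%:R * ((1 - k ^+ n * z^* ^+ 2) * hdot x Px) =
    \sum_j (1 - k * (w j)^* ^+ 2) * hdot (y j) (horner_mx B (faber_factor k (w j)) *m y j).
  have := congr1 (fun v => hdot v Px) sum_y.
  rewrite hdotZl hdot_suml rmorphM rmorph_nat rmorphB rmorph1 rmorphM !rmorphXn /= conjk.
  rewrite -mulrA => <-; apply: eq_bigr => j _.
  by rewrite hdotZl Ly rmorphB rmorph1 rmorphM rmorphXn /= conjk.
have n0 : 0 < n%:R :> C by rewrite ltr0n.
rewrite -(pmulr_rge0 _ n0).
have -> : n%:R * 'Re ((1 - k ^+ n * z^* ^+ 2) * hdot x Px) =
    'Re (n%:R * ((1 - k ^+ n * z^* ^+ 2) * hdot x Px)) by rewrite [RHS]ReMl ?realn.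
by rewrite key raddf_sum /=; apply: sumr_ge0 => j _; apply: posB.
Qed.

End NumericalRange.
Arguments hdot {C m}.

(** * Test vectors and bounds for matrix entries *)

Section Hdot.
Variables (C : numClosedFieldType) (m : nat).
Implicit Types (x y : 'cV[C]_m) (M : 'M[C]_m).

Lemma hdotDl x1 x2 y : hdot (x1 + x2) y = hdot x1 y + hdot x2 y.
Proof. by rewrite /hdot !raddfD /= mulmxDl mxE. Qed.

Lemma hdotDr x y1 y2 : hdot x (y1 + y2) = hdot x y1 + hdot x y2.
Proof. by rewrite /hdot mulmxDr mxE. Qed.

Lemma hdotNr x y : hdot x (- y) = - hdot x y.
Proof. by rewrite /hdot mulmxN mxE. Qed.

Lemma hdotZr a x y : hdot x (a *: y) = a * hdot x y.
Proof. by rewrite /hdot -scalemxAr mxE. Qed.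

Lemma hdot_delta M (i j : 'I_m) :
  hdot (delta_mx i 0) (M *m delta_mx j 0) = M i j.
Proof.
by rewrite /hdot map_delta_mx trmx_delta -rowE -colE !mxE.
Qed.

Lemma hdot_delta2 M (i j : 'I_m) (c : C) :
  let x := delta_mx i 0 + c *: delta_mx j 0 in
  hdot x (M *m x) = M i i + c * M i j + c^* * M j i + c^* * c * M j j.
Proof.
rewrite /= mulmxDr -scalemxAr hdotDl !hdotDr !hdotZl !hdotZr.
by rewrite !hdot_delta; ring.
Qed.

(** For [i = j] the test vector is [(1 + c) e_i]; the terms in [i == j] keep this case in the same
    formula. *)
Lemma hdot_pencil M (i j : 'I_m) (a z c : C) :
  let x := delta_mx i 0 + c *: delta_mx j 0 in
  hdot x ((a%:M - z *: M) *m x) =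
  a * (1 + c * (i == j)%:R + c^* * (i == j)%:R + c^* * c)
  - z * (M i i + c * M i j + c^* * M j i + c^* * c * M j j).
Proof.
rewrite /= hdot_delta2 !mxE (eq_sym j i) !eqxx.
by case: (i == j); rewrite !mulr1n ?mulr0n; ring.
Qed.

End Hdot.

(** With signs [z = e] and [c = f] the weighted form involves only the symmetric part [s01 + s10]
    and the diagonal. *)
Lemma ellipse_form_real (A : comNzRingType) (q d e f s00 s01 s10 s11 : A) :
  e ^+ 2 = 1 -> f ^+ 2 = 1 ->
  (1 - q * e ^+ 2) * ((1 + q * e ^+ 2) * (1 + f * d + f * d + f * f)
    - e * (s00 + f * s01 + f * s10 + f * f * s11)) =
  (1 - q) * ((1 + q) * (2 + 2 * f * d) - e * (s00 + s11 + f * (s01 + s10))).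
Proof. by move=> e2 f2; rewrite -[f * f]expr2 e2 f2; ring. Qed.

(** With [z = e i] and [c = i] the diagonal moves to the imaginary part, leaving the skew part
    [s01 - s10] in the real part. *)
Lemma ellipse_form_imag (A : comNzRingType) (i q d e s00 s01 s10 s11 : A) :
  i * i = -1 -> e ^+ 2 = 1 ->
  (1 - q * (e * - i) ^+ 2) * ((1 + q * (e * i) ^+ 2) * (1 + i * d + (- i) * d + (- i) * i)
    - e * i * (s00 + i * s01 + (- i) * s10 + (- i) * i * s11)) =
  (1 + q) * (2 * (1 - q) + e * (s01 - s10)) + i * (- (1 + q) * e * (s00 + s11)).
Proof.
move=> i2 e2; rewrite !exprMn e2 sqrrN [i ^+ 2]expr2 [- i * i]mulNr i2.
transitivity ((1 + q) * (2 * (1 - q) - e * i * (s00 + s11) - (i * i) * e * (s01 - s10)));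
 first by ring.
by rewrite i2; ring.
Qed.

Lemma map_faber (R S : comNzRingType) (f : {rmorphism R -> S}) (k : R) n :
  map_poly f (faber k n) = faber (f k) n.
Proof.
suff: map_poly f (faber k n) = faber (f k) n /\
      map_poly f (faber k n.+1) = faber (f k) n.+1 by case.
elim: n => [|n [IH1 IH2]]; first by rewrite !faber0 !faber1 rmorph_nat map_polyX.
split=> //; rewrite !faberSS rmorphB !rmorphM /= IH1 IH2.
by rewrite map_polyX map_polyC.
Qed.

(** Testing the numerical range on [e_i + c e_j] with [c] equal to 1, -1 and [i] gives, for [n > 0]
    and [q = k^n], [|F_ij + F_ji| <= 2 (1 + q)] and [|F_ij - F_ji| <= 2 (1 - q)]. Adding them
    removes [q]. *)
Lemma faber_entry_bound (R : rcfType) m (B : 'M[R]_m.+1) (k : R) : 0 <= k -> k < 1 ->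
  (forall (u : R[i]) x, `|u| = 1 ->
     0 <= 'Re ((1 - k%:C%C * u^* ^+ 2) *
       hdot x (horner_mx (map_mx (real_complex R) B) (faber_factor k%:C%C u) *m x))) ->
  forall n i j, `|horner_mx B (faber k n) i j| <= 2.
Proof.
move=> k0 k1 posB [|n] i j.
  rewrite faber0 rmorph_nat -[2%:R]/(1 + 1) !mxE.
  by case: eqP => _; rewrite ?addr0 ?normr0 // -?mulr2n normr_nat.
set F := horner_mx B (faber k n.+1); pose q := k ^+ n.+1.
have q1 : q < 1 by rewrite exprn_ilt1.
have q0 : 0 <= q by rewrite exprn_ge0.
pose d : R := (i == j)%:R.
have realC (r : R) : r%:C%C \is Num.real by apply/complex_realP; exists r.
pose p (z c : R[i]) := (1 - q%:C%C * z^* ^+ 2) *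
   ((1 + q%:C%C * z ^+ 2) * (1 + c * d%:C%C + c^* * d%:C%C + c^* * c) -
    z * ((F i i)%:C%C + c * (F i j)%:C%C + c^* * (F j i)%:C%C + c^* * c * (F j j)%:C%C)).
have pos (z c : R[i]) (x y : R) : `|z| = 1 -> p z c = x%:C%C + 'i * y%:C%C -> 0 <= x.
  move=> z1 pE; rewrite -ler0c -(Re_rect (realC x) (realC y)) -pE /p.
  have := @faber_numerical_range _ _ (map_mx (real_complex R) B) (k%:C%C) _ _ posB
      n.+1 z (delta_mx i 0 + c *: delta_mx j 0) isT z1.
  rewrite lecR ltcR => /(_ k0 k1).
  have -> : horner_mx (map_mx (real_complex R) B)
      (1 + (k%:C%C ^+ n.+1 * z ^+ 2)%:P - z%:P * faber k%:C%C n.+1) =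
      (1 + q%:C%C * z ^+ 2)%:M - z *: map_mx (real_complex R) F.
    rewrite -map_faber mul_polyC raddfB raddfD /= rmorph1 horner_mx_C.
    rewrite [(1 + _)%:M]raddfD /= rmorphXn horner_mxZ; congr (_ - _ *: _).
    exact/esym/map_horner_mx.
  rewrite hdot_pencil !mxE -rmorphXn -/q.
  by rewrite (_ : d%:C%C = (i == j)%:R) // rmorph_nat.
clearbody q d F.
have q1' : 0 < 1 - q by rewrite subr_gt0.
have q0' : 0 < 1 + q by rewrite ltr_wpDr.
have conjR (r : R) : (r%:C%C)^* = r%:C%C by apply: conj_Creal.
have sqrC (e : R) : e ^+ 2 = 1 -> e%:C%C ^+ 2 = 1 :> R[i].
  by move=> e2; rewrite -rmorphXn /= e2 rmorph1.
have normC (e : R) : e ^+ 2 = 1 -> `|e%:C%C| = 1 :> R[i].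
  by move=> /sqrC e2; apply/eqP; rewrite -sqrp_eq1 // -normrX e2 normr1.
have Hre (e f : R) : e ^+ 2 = 1 -> f ^+ 2 = 1 ->
    e * (F i i + F j j + f * (F i j + F j i)) <= (1 + q) * (2 + 2 * f * d).
  move=> e2 f2.
  suff /(pos _ _ _ _ (normC _ e2)) : p e%:C%C f%:C%C =
      ((1 - q) * ((1 + q) * (2 + 2 * f * d)
     - e * (F i i + F j j + f * (F i j + F j i))))%:C%C + 'i * 0%:C%C.
    by rewrite pmulr_rge0 // subr_ge0; apply.
  rewrite /p !conjR ellipse_form_real ?sqrC // rmorph0 mulr0 addr0.
  by rewrite !(rmorphD, rmorphB, rmorphM, rmorph1, rmorphN) ?rmorph_nat.
have Him (e : R) : e ^+ 2 = 1 -> - e * (F i j - F j i) <= 2 * (1 - q).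
  move=> e2.
  have z1 : `|e%:C%C * 'i| = 1 :> R[i] by rewrite normrM normCi mulr1 normC.
  suff /(pos _ _ _ _ z1) : p (e%:C%C * 'i) 'i =
      ((1 + q) * (2 * (1 - q) + e * (F i j - F j i)))%:C%C +
      'i * (- (1 + q) * e * (F i i + F j j))%:C%C.
    by rewrite pmulr_rge0 // => ?; lra.
  rewrite /p rmorphM /= conjR conjCi ellipse_form_imag ?sqrC //; last first.
    by rewrite -expr2 sqrCi.
  by rewrite !(rmorphD, rmorphB, rmorphM, rmorph1, rmorphN) ?rmorph_nat.
have N1 : (- 1 : R) ^+ 2 = 1 by rewrite sqrrN expr1n.
have P1 : (1 : R) ^+ 2 = 1 by rewrite expr1n.
(* Adding the two instances with the same product [e f] cancels the diagonal entries and [d]. *)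
move: (Hre _ _ P1 P1) (Hre _ _ P1 N1) (Hre _ _ N1 P1) (Hre _ _ N1 N1).
move: (Him _ P1) (Him _ N1).
by rewrite ler_norml => *; apply/andP; split; lra.
Qed.

(** * Fields of values contained in an ellipse *)

(** The real part is [1 - k^2] times the gap in the supporting-line inequality [r P - t Q <= 1] of
    the unit disk; the corresponding point of the ellipse is [(1 + k) P + i (1 - k) Q]. *)
Lemma ellipse_support (A : comNzRingType) (i k r t P Q : A) :
  i * i = -1 -> r ^+ 2 + t ^+ 2 = 1 ->
  (1 - k * (r - i * t) ^+ 2) *
    (1 + k * (r + i * t) ^+ 2 - (r + i * t) * ((1 + k) * P + i * ((1 - k) * Q))) =
  (1 - k ^+ 2) * (1 - (r * P - t * Q))
  + i * (4 * k * r * t - (1 - k) ^+ 2 * r * Q - (1 + k) ^+ 2 * t * P).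
Proof.
move=> i2 rt1; set u := r + i * t; set v := r - i * t.
set w := (1 + k) * P + _.
have vu : v * u = 1.
  transitivity (r ^+ 2 - (i * i) * t ^+ 2); first by rewrite /u /v; ring.
  by rewrite i2 mulN1r opprK.
transitivity (1 + k * (u ^+ 2 - v ^+ 2) - k ^+ 2 * (v * u) ^+ 2
  - u * w + k * v * (v * u) * w).
  by ring.
rewrite vu /u /v /w.
transitivity (1 - k ^+ 2 - (1 - k ^+ 2) * (r * P + (i * i) * t * Q)
  + i * (4 * k * r * t - (1 - k) ^+ 2 * r * Q - (1 + k) ^+ 2 * t * P)); first by ring.
by rewrite i2; ring.
Qed.

Section FieldOfValues.
Variable R : realType.
Local Notation C := (R[i]%C).

Lemma cauchy_unit (r t P Q : R) : r ^+ 2 + t ^+ 2 = 1 -> P ^+ 2 + Q ^+ 2 <= 1 ->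
  0 <= 1 - (r * P - t * Q).
Proof. by move=> h1 h2; have := sqr_ge0 (r - P); have := sqr_ge0 (t + Q); nra. Qed.

Lemma realc_real (r : R) : (r%:C%C : C) \is Num.real.
Proof. by apply/complex_realP; exists r. Qed.

Lemma conj_realc (r : R) : (r%:C%C : C)^* = r%:C%C.
Proof. exact/conj_Creal/realc_real. Qed.

Lemma Re_ge0 (z : C) (x y : R) : z = x%:C%C + 'i * y%:C%C -> 0 <= x -> 0 <= 'Re z.
Proof. by move=> ->; rewrite Re_rect ?realc_real // ler0c. Qed.

Lemma norm2_eq0 N (x : 'cV[C]_N) : norm2 x = 0 -> x = 0.
Proof.
rewrite /norm2 => /eqP; rewrite sqrtC_eq0 psumr_eq0 => [/allP h|i _]; last first.
  exact: exprn_ge0.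
apply/matrixP => i j; rewrite ord1 mxE; have := h i (mem_index_enum _).
by rewrite /= expf_eq0 /= normr_eq0 => /eqP.
Qed.

Lemma norm2Z N (a : C) (x : 'cV[C]_N) : norm2 (a *: x) = `|a| * norm2 x.
Proof.
rewrite /norm2; under eq_bigr do rewrite mxE normrM exprMn.
rewrite -mulr_sumr sqrtCM ?sqrCK// nnegrE ?exprn_ge0//.
by apply: sumr_ge0 => i _; exact: exprn_ge0.
Qed.

Lemma hdot_norm2 N (x : 'cV[C]_N) : hdot x x = norm2 x ^+ 2.
Proof.
rewrite /norm2 sqrtCK /hdot mxE; apply: eq_bigr => i _.
by rewrite !mxE mulrC -normCK.
Qed.

Lemma norm2_ge0 N (x : 'cV[C]_N) : 0 <= norm2 x.
Proof. by rewrite sqrtC_ge0; apply: sumr_ge0 => i _; exact: exprn_ge0. Qed.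

(** Homogeneous form of the inclusion: [s] is the squared norm of [x], and [P], [Q] are coordinates
    in which the ellipse becomes the unit disk. The zero vector takes [s = 0]. *)
Lemma elliptic_form N (A : 'M[R]_N) (a b c : R) (x : 'cV[C]_N) :
  0 < a -> 0 < b ->
  field_of_values (complexify A) `<=` elliptic_region a b (c%:C%C) ->
  exists s P Q : R, [/\ 0 <= s, P ^+ 2 + Q ^+ 2 <= 1,
    hdot x x = s%:C%C &
    hdot x (complexify A *m x) =
      s%:C%C * (c%:C%C + a%:C%C * P%:C%C + 'i * (b%:C%C * Q%:C%C))].
Proof.
move=> a0 b0 FA; have [x0|x0] := eqVneq (norm2 x) 0.
  exists 0, 0, 0; rewrite (norm2_eq0 _ _ x0) /hdot !mulmx0 mxE expr0n addr0 ler01.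
  by rewrite rmorph0 mul0r.
have /complex_realP[n nE] := ger0_real (norm2_ge0 _ x).
have n0 : n != 0 by apply: contra x0 => /eqP n0; rewrite nE n0.
set y := (norm2 x)^-1 *: x.
have y1 : norm2 y = 1.
  by rewrite norm2Z ger0_norm ?invr_ge0 ?norm2_ge0// mulVf.
have xy : x = n%:C%C *: y by rewrite /y -nE scalerA divff // scale1r.
have : elliptic_region a b c%:C%C (hdot y (complexify A *m y)).
  by apply: FA; exists y => //; rewrite /hdot mulmxA.
case pq: (hdot y _) => [p q] Epq.
exists (n ^+ 2), ((p - c) / a), (q / b); split => //.
- exact: sqr_ge0.
- by move: Epq; rewrite /elliptic_region /= subr0.
- by rewrite hdot_norm2 nE rmorphXn.
- rewrite {1 2}xy -scalemxAr hdotZl hdotZr conj_realc pq mulrA -expr2 -rmorphXn.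
  congr (_ * _); rewrite -!rmorphM /= ![_ * (_ / _)]mulrC !divfK ?gt_eqF//.
  by rewrite -rmorphD /= subrKC [LHS]complexE.
Qed.

Lemma elliptic_positivity m (A : 'M[R]_m.+1) (a b c : R) : 0 < b -> b <= a ->
  field_of_values (complexify A) `<=` elliptic_region a b (c%:C%C) ->
  let k := (a - b) / (a + b) in
  let B := ((a + b) / 2)^-1 *: (A - c%:M) in
  forall (u : C) x, `|u| = 1 ->
     0 <= 'Re ((1 - k%:C%C * u^* ^+ 2) *
       hdot x (horner_mx (map_mx (real_complex R) B) (faber_factor k%:C%C u) *m x)).
Proof.
move=> b0 ba FA k B u x u1.
have a0 : 0 < a by apply: lt_le_trans ba.
have ab0 : 0 < a + b by rewrite addr_gt0.
have [s [P [Q [s0 PQ xx xAx]]]] := elliptic_form _ A a b c x a0 b0 FA.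
have -> : hdot x (horner_mx (map_mx (real_complex R) B) (faber_factor k%:C%C u) *m x) =
  s%:C%C * (1 + k%:C%C * u ^+ 2 -
    u * ((1 + k%:C%C) * P%:C%C + 'i * ((1 - k%:C%C) * Q%:C%C))).
  rewrite /faber_factor -polyC_exp -polyCM mul_polyC raddfB raddfD /=.
  rewrite horner_mxZ rmorph1 horner_mx_C horner_mx_X.
  rewrite mulmxBl mulmxDl mul1mx mul_scalar_mx -scalemxAl.
  rewrite !(hdotDr, hdotNr, hdotZr).
  have -> : map_mx (real_complex R) B =
      (((a + b) / 2)^-1)%:C%C *: (complexify A - c%:C%C%:M).
    by rewrite map_mxZ map_mxB map_scalar_mx.
  rewrite -scalemxAl mulmxBl mul_scalar_mx.
  rewrite !(hdotDr, hdotNr, hdotZr) xx xAx.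
  (* Dividing by [rho = (a + b) / 2] turns the semi-axes into [a / rho = 1 + k] and
     [b / rho = 1 - k]. *)
  have -> : 1 + k%:C%C = (((a + b) / 2)^-1)%:C%C * a%:C%C.
    by rewrite -rmorphM -[1]/(1%:C%C) -rmorphD; congr (_%:C%C); rewrite /k; field; lra.
  have -> : 1 - k%:C%C = (((a + b) / 2)^-1)%:C%C * b%:C%C.
    by rewrite -rmorphM -[1]/(1%:C%C) -rmorphB; congr (_%:C%C); rewrite /k; field; lra.
  by ring.
clear xx xAx; case: u u1 => r t u1.
have rt1 : r ^+ 2 + t ^+ 2 = 1.
  by apply: complexI; rewrite (add_Re2_Im2 (r +i* t)%C) u1 expr1n.
have -> : (r +i* t)%C = r%:C%C + 'i * t%:C%C by rewrite [LHS]complexE.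
rewrite rmorphD rmorphM /= !conj_realc conjCi mulNr mulrCA.
rewrite ellipse_support; first last.
- by rewrite -!rmorphXn -rmorphD /= rt1.
- by rewrite -expr2 sqrCi.
apply: (Re_ge0 _ (s * ((1 - k ^+ 2) * (1 - (r * P - t * Q))))
    (s * (4 * k * r * t - (1 - k) ^+ 2 * r * Q - (1 + k) ^+ 2 * t * P))).
  rewrite [RHS](_ : _ = s%:C%C *
    ((1 - k%:C%C ^+ 2) * (1 - (r%:C%C * P%:C%C - t%:C%C * Q%:C%C))
     + 'i * (4 * k%:C%C * r%:C%C * t%:C%C - (1 - k%:C%C) ^+ 2 * r%:C%C * Q%:C%C
     - (1 + k%:C%C) ^+ 2 * t%:C%C * P%:C%C))) //.
  by rewrite [RHS]mulrDr [X in _ = _ + X]mulrCA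
    !(rmorphM, rmorphXn, rmorphD, rmorphN, rmorph1) /=.
apply: mulr_ge0 => //; apply: mulr_ge0; last exact: cauchy_unit.
rewrite subr_ge0 expr_le1 // /k ?ler_pdivrMr ?divr_ge0 ?subr_ge0 //; lra.
Qed.

Lemma field_of_values_conj N (A : 'M[R]_N) (z : C) :
  field_of_values (complexify A) z -> field_of_values (complexify A) z^*.
Proof.
move=> [x x1 <-]; exists (map_mx Num.conj x).
  rewrite /= -[RHS]x1 /norm2; congr sqrtC; apply: eq_bigr => i _.
  by rewrite mxE norm_conjC.
transitivity (map_mx Num.conj ((map_mx Num.conj x)^T *m complexify A *m x) 0 0).
  rewrite !map_mxM map_trmx; congr ((_ *m _ *m _) 0 0).
  by apply/matrixP => i j; rewrite !mxE; exact/esym/conj_realc.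
by rewrite mxE.
Qed.

(** The field of values of a real matrix is symmetric about the real axis. Averaging the
    inequalities at [z] and its conjugate leaves the square of the imaginary part of [c] as a
    nonnegative term to drop. Shifting by the centre then keeps matrices real. *)
Lemma elliptic_center_real N (A : 'M[R]_N) (a b : R) (c : C) : 0 < a -> 0 < b ->
  field_of_values (complexify A) `<=` elliptic_region a b c ->
  field_of_values (complexify A) `<=` elliptic_region a b ((complex.Re c)%:C%C).
Proof.
move=> a0 b0 FA z Fz; have := FA _ Fz; have := FA _ (field_of_values_conj _ _ _ Fz).
case: z {Fz} => p q; case: c {FA} => c1 c2 /=; rewrite /elliptic_region /=.
rewrite subr0 !expr_div_n => h1 h2.
have h3 : 0 <= c2 ^+ 2 / b ^+ 2 by rewrite mulr_ge0 ?invr_ge0 ?sqr_ge0.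
by lra.
Qed.

End FieldOfValues.

(** * Distances and powers of adjacency matrices *)

Section Distances.
Variables (R : realType) (N : nat).
Implicit Types (G H : wdigraph R N) (B : 'M[R]_N) (dE : {set 'I_N * 'I_N}).

(** Integrality lets a finite [delta] bound polynomial degrees and makes [delta + 1] a natural
    exponent. *)
Definition infty_or_nat (x : \bar R) := x = +oo%E \/ exists n : nat, x = (n%:R)%:E.

Lemma dist_infty_or_nat G k l : infty_or_nat (dist G k l).
Proof.
have [[p kpl]|no] := pselect (exists p, walk G k l p); last first.
  left; rewrite /dist (_ : [set _ | _ in _] = set0) ?ereal_inf0 //.
  by apply/seteqP; split=> // x [p kpl]; case: no; exists p.
right; have ex : exists n, `[< exists2 p, walk G k l p & size p = n >].
  by exists (size p); apply/asboolP; exists p.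
exists (ex_minn ex); case: ex_minnP => n /asboolP[q kql qn] n_min.
apply/eqP; rewrite eq_le; apply/andP; split.
  by apply: ereal_inf_lbound; exists q => //; rewrite qn.
apply: le_ereal_inf_tmp => _ [r krl <-]; rewrite lee_fin ler_nat.
by apply: n_min; apply/asboolP; exists r.
Qed.

Lemma infty_or_nat_min x y : infty_or_nat x -> infty_or_nat y ->
  infty_or_nat (Order.min x y).
Proof. by move=> hx hy; rewrite minElt; case: ifP. Qed.

Lemma infty_or_natD x y : infty_or_nat x -> infty_or_nat y -> infty_or_nat (x + y)%E.
Proof.
move=> [->|[n ->]] [->|[m ->]]; rewrite ?addeNy ?addey ?addye //; try by left.
by right; exists (n + m)%N; rewrite natrD.
Qed.

Lemma dist_sets_infty_or_nat G k l (S T : {set 'I_N}) :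
  infty_or_nat (dist_to_set G k S + dist_from_set G T l)%E.
Proof.
apply: infty_or_natD; apply: (big_ind infty_or_nat) => [||s _];
  by [left|exact: infty_or_nat_min|exact: dist_infty_or_nat].
Qed.

Lemma dist_to_set_le G k s p (S : {set 'I_N}) n : s \in S -> walk G k s p ->
  (size p <= n)%N -> (dist_to_set G k S <= (n%:R)%:E)%E.
Proof.
move=> sS ksp pn; apply: (@le_trans _ _ (dist G k s)); first exact: bigmin_le_cond.
apply: ge_ereal_inf; exists ((size p)%:R)%:E; last by rewrite lee_fin ler_nat.
by exists p.
Qed.

Lemma dist_from_set_le G t l p (T : {set 'I_N}) n : t \in T -> walk G t l p ->
  (size p <= n)%N -> (dist_from_set G T l <= (n%:R)%:E)%E.
Proof.
move=> tT tlp pn; apply: (@le_trans _ _ (dist G t l)); first exact: bigmin_le_cond.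
apply: ge_ereal_inf; exists ((size p)%:R)%:E; last by rewrite lee_fin ler_nat.
by exists p.
Qed.

(** The diagonal is left free because adjacency matrices get shifted by multiples of the
    identity. *)
Definition edge_supported B G :=
  forall u v, B u v != 0 -> u = v \/ (u, v) \in edges G.

Lemma exprmx_entry_neq0 B i u v : (B ^+ i.+1) u v != 0 ->
  exists w, B u w != 0 /\ (B ^+ i) w v != 0.
Proof.
rewrite exprS !mxE => /eqP nz; have [w h] : exists w, B u w * (B ^+ i) w v != 0.
  apply: contrapT => no; apply: nz; apply: big1 => w _.
  by apply/eqP; apply: contrapT => /negP hw; apply: no; exists w.
by exists w; move: h; rewrite mulf_eq0 negb_or => /andP[].
Qed.

Lemma walk_cons G u w v p : (u, w) \in edges G -> walk G w v p -> walk G u v (w :: p).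
Proof. by move=> uw [wp <-]; split => //=; rewrite uw. Qed.

(** A diagonal factor stays at its vertex, so the walk may be shorter than [i]. *)
Lemma exprmx_walk B G i u v : edge_supported B G -> (B ^+ i) u v != 0 ->
  exists2 p, walk G u v p & (size p <= i)%N.
Proof.
move=> BG; elim: i u => [|i IHi] u.
  rewrite expr0 mxE; have [->|_] := eqVneq u v; last by rewrite eqxx.
  by exists [::].
move=> /exprmx_entry_neq0[w [/BG uw /IHi[p wp pi]]].
case: uw => [->|uw]; first by exists p => //; exact: leqW.
by exists (w :: p) => //; exact: walk_cons.
Qed.

(* The portion of a walk after its last modified edge is a walk of the original
   graph. *)
Lemma exprmx_walk_modified B G H dE i u v : modified_within G H dE ->
  edge_supported B H -> (B ^+ i) u v != 0 ->
  (exists2 p, walk G u v p & (size p <= i)%N) \/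
  (exists2 t, t \in targets dE & exists2 p, walk G t v p & (size p <= i)%N).
Proof.
move=> GH BH; elim: i u => [|i IHi] u.
  rewrite expr0 mxE; have [->|_] := eqVneq u v; last by rewrite eqxx.
  by left; exists [::].
move=> /exprmx_entry_neq0[w [/BH uw /IHi[[p wp pi]|[t tT [p tp pi]]]]]; last first.
  by right; exists t => //; exists p => //; exact: leqW.
case: uw => [->|uw]; first by left; exists p => //; exact: leqW.
have [uwE|uwE] := boolP ((u, w) \in dE).
  right; exists w; first by apply/imsetP; exists (u, w).
  by exists p => //; exact: leqW.
left; exists (w :: p) => //; apply: walk_cons => //.
by have [-> _] := GH _ uwE.
Qed.

(** Factors [B] are replaced by [Bt] one at a time. A nonzero term of [B^m (B - Bt) Bt^j] gives
    walks in [G], of length at most [m] from [k] to a source and at most [j] from a target to [l].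
    This contradicts [m + j + 1 = i] being at most the sum of the distances. *)
Lemma exprmx_modified B Bt G H dE k l i : modified_within G H dE ->
  edge_supported B G -> edge_supported Bt H ->
  (forall u v, (u, v) \notin dE -> B u v = Bt u v) ->
  ((i%:R)%:E <= dist_to_set G k (sources dE) + dist_from_set G (targets dE) l)%E ->
  (B ^+ i) k l = (Bt ^+ i) k l.
Proof.
move=> GH BG BtH Beq i_le.
suff main j : (j <= i)%N -> (B ^+ i) k l = (B ^+ (i - j) * Bt ^+ j) k l.
  by rewrite (main i (leqnn i)) subnn expr0 mul1r.
elim: j => [|j IHj] ji; first by rewrite subn0 expr0 mulr1.
rewrite (IHj (ltnW ji)) -[(i - j)%N](@subnSK j i) //; set m := (i - j.+1)%N.
have E : B ^+ m.+1 * Bt ^+ j = B ^+ m * Bt ^+ j.+1 + B ^+ m * ((B - Bt) * Bt ^+ j).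
  by rewrite -mulrDr [Bt ^+ j.+1]exprS -mulrDl subrKC exprSr mulrA.
rewrite E [LHS]mxE -[RHS]addr0; congr (_ + _).
rewrite mxE; apply: big1 => u _; rewrite mxE mulr_sumr; apply: big1 => v _.
have [uvE|/Beq uvB] := boolP ((u, v) \in dE); last first.
  by rewrite !mxE uvB subrr mul0r mulr0.
have [->|ku] := eqVneq ((B ^+ m) k u) 0; first by rewrite mul0r.
have [->|vl] := eqVneq ((Bt ^+ j) v l) 0; first by rewrite !mulr0.
exfalso.
have [p kp pm] := exprmx_walk _ _ _ _ _ BG ku.
have kS : (dist_to_set G k (sources dE) <= (m%:R)%:E)%E.
  by apply: (dist_to_set_le _ _ u) kp pm => //; apply/imsetP; exists (u, v).
have Tl : (dist_from_set G (targets dE) l <= (j%:R)%:E)%E.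
  have vT : v \in targets dE by apply/imsetP; exists (u, v).
  have [[q vq qj]|[t tT [q tq qj]]] := exprmx_walk_modified _ _ _ _ _ _ _ GH BtH vl.
    exact: dist_from_set_le vq qj.
  exact: dist_from_set_le tq qj.
have := le_trans i_le (leeD kS Tl).
by rewrite -EFinD -natrD lee_fin ler_nat -{1}(subnK ji) -/m addnS ltnn.
Qed.

End Distances.

(** * The matrix exponential of a shifted matrix *)

Section ExponentialShift.
Variable R : realType.
Implicit Types f g F G : nat -> R.

Lemma cvg_mx_entries m n (u : nat -> 'M[R]_(m, n)) (M : 'M[R]_(m, n)) :
  (forall i j, u t i j @[t --> \oo] --> M i j) -> u @ \oo --> M.
Proof.
move=> uM A [P MP PA]; rewrite /= nbhs_filterE.
have : \forall t \near \oo, forall ij : 'I_m * 'I_n, P ij.1 ij.2 (u t ij.1 ij.2).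
  by apply: filter_forall => -[i j] /=; exact: uM (MP i j).
by apply: filterS => t Pt; apply: PA => i j; exact: Pt (i, j).
Qed.

Lemma sum_triangle f g n :
  \sum_(0 <= m < n) \sum_(0 <= i < m.+1) f i * g (m - i)%N =
  \sum_(0 <= i < n) f i * \sum_(0 <= j < n - i) g j.
Proof.
elim: n => [|n IHn]; first by rewrite !big_nil.
rewrite big_nat_recr //= IHn [in LHS]big_nat_recr //= addrA -big_split /=.
rewrite [RHS]big_nat_recr //= subSnn subnn big_nat1; congr (_ + _).
apply: eq_big_nat => i /andP[_ /ltnW i_n].
by rewrite subSn // big_nat_recr //= mulrDr.
Qed.

(** The contribution of the index pairs below [n] with sum at least [n]; its vanishing in the limit
    is the Cauchy product formula. *)
Definition cauchy_defect f g n :=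
  series f n * series g n - \sum_(0 <= m < n) \sum_(0 <= i < m.+1) f i * g (m - i)%N.

Lemma cauchy_defectE f g n :
  cauchy_defect f g n = \sum_(0 <= i < n) f i * \sum_(n - i <= j < n) g j.
Proof.
rewrite /cauchy_defect sum_triangle /series /= mulr_suml -sumrB.
apply: eq_big_nat => i /andP[_ i_n]; rewrite -mulrBr; congr (_ * _).
by rewrite [X in X - _](@big_cat_nat _ _ _ (n - i)%N) //= ?leq_subr //
  addrAC subrr add0r.
Qed.

Lemma norm_cauchy_defect f g F G n :
  (forall i, `|f i| <= F i) -> (forall i, `|g i| <= G i) ->
  `|cauchy_defect f g n| <= cauchy_defect F G n.
Proof.
move=> fF gG; rewrite !cauchy_defectE; apply: le_trans (ler_norm_sum _ _ _) _.
apply: ler_sum => i _; rewrite normrM; apply: ler_pM => //.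
by apply: le_trans (ler_norm_sum _ _ _) _; apply: ler_sum.
Qed.

(** Stated over a module so as to serve both powers of matrices and, through [R^o], powers of
    scalars. *)
Lemma binomial_exp_coeff (V : lmodType R) (x : nat -> V) (c : R) n :
  (n`!%:R)^-1 *: (\sum_(i < n.+1) (c ^+ (n - i) *: x i) *+ 'C(n, i)) =
  \sum_(0 <= i < n.+1) exp_coeff c (n - i)%N *: ((i`!%:R)^-1 *: x i).
Proof.
rewrite big_mkord scaler_sumr; apply: eq_bigr => i _.
rewrite -scaler_nat !scalerA; congr (_ *: _).
have i_n : (i <= n)%N by rewrite -ltnS.
have nz m : m`!%:R != 0 :> R by rewrite pnatr_eq0 -lt0n fact_gt0.
rewrite /exp_coeff /= -(bin_fact i_n) !natrM.
by field; rewrite !nz pnatr_eq0 -lt0n bin_gt0 i_n.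
Qed.

Lemma exp_coeffD (x y : R) n :
  exp_coeff (x + y) n = \sum_(0 <= i < n.+1) exp_coeff x i * exp_coeff y (n - i)%N.
Proof.
rewrite {1}/exp_coeff /= addrC exprDn mulrC.
transitivity (\sum_(0 <= i < n.+1)
    exp_coeff y (n - i)%N *: ((i`!%:R)^-1 *: (x ^+ i : R^o))).
  exact: (binomial_exp_coeff R^o (fun i => x ^+ i) y n).
by apply: eq_big_nat => i _; rewrite /exp_coeff /= /GRing.scale /= mulrC [_^-1 * _]mulrC.
Qed.

(** For scalars the limit follows from the functional equation of [expR]; this sequence will
    dominate the defect of matrix entries. *)
Lemma cvg_cauchy_defect_exp (x y : R) :
  cauchy_defect (exp_coeff x) (exp_coeff y) n @[n --> \oo] --> (0 : R).
Proof.
have -> : (0 : R) = expR x * expR y - expR (x + y) by rewrite expRD subrr.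
rewrite /cauchy_defect; under eq_fun do under eq_bigr do rewrite -exp_coeffD.
by apply: cvgB; [apply: cvgM|]; exact: is_cvg_series_exp_coeff.
Qed.

Section Matrix.
Variables (N : nat) (X : 'M[R]_N.+1).

Lemma exprmx_entry_bound n k l : `|(X ^+ n) k l| <= (\sum_i \sum_j `|X i j|) ^+ n.
Proof.
set K := \sum_i _; elim: n k => [|n IHn] k.
  by rewrite !expr0 mxE; case: eqP => _; rewrite ?normr0 ?normr1.
rewrite exprS mxE exprS; apply: le_trans (ler_norm_sum _ _ _) _.
apply: (@le_trans _ _ (\sum_j `|X k j| * K ^+ n)).
  by apply: ler_sum => j _; rewrite normrM ler_wpM2l.
rewrite -mulr_suml ler_wpM2r ?exprn_ge0 //.
  by apply: sumr_ge0 => i _; apply: sumr_ge0.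
rewrite /K [leRHS](bigD1 k) //= lerDl; apply: sumr_ge0 => i _; exact: sumr_ge0.
Qed.

Definition exp_entry k l n : R := (n`!%:R)^-1 * (X ^+ n) k l.

Lemma exp_entry_bound k l n :
  `|exp_entry k l n| <= exp_coeff (\sum_i \sum_j `|X i j|) n.
Proof.
rewrite normrM /exp_coeff /= mulrC [`|_^-1|]ger0_norm ?invr_ge0 //.
by rewrite ler_wpM2r ?invr_ge0 // exprmx_entry_bound.
Qed.

Lemma is_cvg_exp_entry k l : cvgn (series (exp_entry k l)).
Proof.
apply: normed_cvg; apply: series_le_cvg (exp_entry_bound k l) _ => //.
- by move=> n; apply: le_trans (exp_entry_bound k l n).
- exact: is_cvg_series_exp_coeff.
Qed.

End Matrix.

Lemma exp_entry_shift N (X : 'M[R]_N.+1) (c : R) k l n :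
  exp_entry N (c%:M + X) k l n =
  \sum_(0 <= i < n.+1) exp_entry N X k l i * exp_coeff c (n - i)%N.
Proof.
have := binomial_exp_coeff _ (fun i => X ^+ i) c n.
have -> : \sum_(i < n.+1) (c ^+ (n - i) *: X ^+ i) *+ 'C(n, i) = (c%:M + X) ^+ n.
  rewrite exprDn_comm; last by rewrite /GRing.comm -!mulmxE scalar_mxC.
  apply: eq_bigr => i _; congr (_ *+ _).
  by rewrite -rmorphXn /= -mulmxE mul_scalar_mx.
move=> /matrixP/(_ k l); rewrite mxE summxE => E; rewrite /exp_entry E.
by apply: eq_bigr => i _; rewrite !mxE mulrC.
Qed.

Lemma cvg_exp_entry_shift N (X : 'M[R]_N.+1) (c : R) k l :
  series (exp_entry N (c%:M + X) k l) @ \oo -->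
    expR c * limn (series (exp_entry N X k l)).
Proof.
(* The defect is squeezed by that of the scalar series at the sum of all [|X i j|] and at [|c|]. *)
have D0 : cauchy_defect (exp_entry N X k l) (exp_coeff c) n @[n --> \oo] --> (0 : R).
  have D1 := cvg_cauchy_defect_exp (\sum_i \sum_j `|X i j|) `|c|.
  have D2 n : `|cauchy_defect (exp_entry N X k l) (exp_coeff c) n| <=
      cauchy_defect (exp_coeff (\sum_i \sum_j `|X i j|)) (exp_coeff `|c|) n.
    apply: norm_cauchy_defect => i; first exact: exp_entry_bound.
    by rewrite /exp_coeff /= normrM normrX [`|_^-1|]ger0_norm ?invr_ge0.
  have D3 := cvgN D1; rewrite oppr0 in D3.
  apply: (squeeze_cvgr _ (D3 _) D1).
  by near=> n; rewrite -ler_norml; exact: D2.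
have -> : series (exp_entry N (c%:M + X) k l) = (fun n =>
    series (exp_coeff c) n * series (exp_entry N X k l) n
    - cauchy_defect (exp_entry N X k l) (exp_coeff c) n).
  apply/funext => n; rewrite /cauchy_defect mulrC subKr /series /=.
  by apply: eq_bigr => i _; rewrite exp_entry_shift.
rewrite -[X in _ --> X]subr0; apply: cvgB D0; apply: cvgM.
  exact: is_cvg_series_exp_coeff.
exact: is_cvg_exp_entry.
Unshelve. all: by end_near.
Qed.

Lemma expmx_entry N (A : 'M[R]_N.+1) k l :
  series (exp_entry N A k l) @ \oo --> expmx A k l.
Proof.
pose u : nat -> 'M[R]_N.+1 := series (fun n : nat => (n`!%:R)^-1 *: A ^+ n).
have uE t i j : u t i j = series (exp_entry N A i j) t.
  by rewrite /u /series /= summxE; apply: eq_bigr => n _; rewrite mxE.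
have uM : u @ \oo --> (\matrix_(i, j) limn (series (exp_entry N A i j)) : 'M[R]_N.+1).
  apply: cvg_mx_entries => i j; under eq_fun do rewrite uE.
  by rewrite mxE; exact: is_cvg_exp_entry.
rewrite /expmx -/u (cvg_lim _ uM) ?mxE; [exact: is_cvg_exp_entry|exact: norm_hausdorff].
Qed.

(** This approximates the exponential by polynomials in the shifted matrix, to which the Faber
    estimates apply. *)
Lemma expmx_entry_shift N (A : 'M[R]_N.+1) (c : R) k l :
  expR c * series (exp_entry N (A - c%:M) k l) n @[n --> \oo] --> expmx A k l.
Proof.
have h := cvg_exp_entry_shift N (A - c%:M) c k l.
rewrite subrKC in h; have <- := cvg_unique (@norm_hausdorff _ R) h (expmx_entry _ A k l).
by apply: cvgMr; exact: is_cvg_exp_entry.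
Qed.

End ExponentialShift.

(** * Estimates in terms of the ellipse *)

Section Domination.
Variables (R : realType) (kappa : R).

Lemma faber_joukowski (t : R) n : t != 0 ->
  (faber kappa n).[t + kappa / t] = t ^+ n + (kappa / t) ^+ n.
Proof.
move=> t0; suff: (faber kappa n).[t + kappa / t] = t ^+ n + (kappa / t) ^+ n /\
    (faber kappa n.+1).[t + kappa / t] = t ^+ n.+1 + (kappa / t) ^+ n.+1 by case.
elim: n => [|n [IH1 IH2]].
  by rewrite faber0 faber1 -polyC_natr hornerC hornerX !expr0 !expr1.
split=> //; rewrite faberSS hornerD hornerN !hornerM hornerX hornerC IH1 IH2.
by rewrite !exprS; field.
Qed.

(** Later the [(k, l)] entry of [p(B) - p(Bt)]. *)
Variable phi : {poly R} -> R.
Hypothesis phiD : forall p q, phi (p + q) = phi p + phi q.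
Hypothesis phiZ : forall a p, phi (a *: p) = a * phi p.

Lemma functional_faber_eq0 d : (forall i, (i <= d)%N -> phi 'X^i = 0) ->
  forall j, (j <= d)%N -> phi (faber kappa j) = 0.
Proof.
(* The monomial factor absorbs the [X] of the recurrence, which relates consecutive indices; hence
   two of them are carried. *)
move=> phi0; suff main j : (forall i, (i + j <= d)%N -> phi ('X^i * faber kappa j) = 0) /\
    (forall i, (i + j.+1 <= d)%N -> phi ('X^i * faber kappa j.+1) = 0).
  by move=> j jd; have [/(_ 0%N) + _] := main j; rewrite expr0 mul1r => ->.
elim: j => [|j [IH1 IH2]]; split=> i id.
- rewrite faber0 mulr_natr mulr2n phiD phi0 ?addr0 //.
  by rewrite -(addn0 i).
- by rewrite faber1 -exprSr phi0 // -addn1.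
- exact: IH2.
- have -> : 'X^i * faber kappa j.+2 =
      'X^(i.+1) * faber kappa j.+1 + (- kappa) *: ('X^i * faber kappa j).
    by rewrite faberSS exprSr -mul_polyC polyCN; ring.
  rewrite phiD phiZ IH1 ?IH2 ?mulr0 ?addr0 //.
  + by rewrite addSnnS.
  + by apply: leq_trans id; rewrite leq_add2l ltnW.
Qed.

(** Induction on [m] for all [j] at once: each power of [X] is absorbed by
    [X F_(j+1) = F_(j+2) + kappa F_j] or [X F_0 = 2 F_1], both with nonnegative coefficients. The
    case [j = 0] is twice the claim. *)
Lemma functional_monomial_bound (x K : R) : 0 <= kappa ->
  (forall j, `|phi (faber kappa j)| <= K * (faber kappa j).[x]) ->
  forall m, `|phi 'X^m| <= K * x ^+ m.
Proof.
move=> k0 phiF.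
have main m j : `|phi ('X^m * faber kappa j)| <= K * (x ^+ m * (faber kappa j).[x]).
  elim: m j => [|m IHm] j; first by rewrite !expr0 !mul1r.
  case: j => [|j].
    have -> : 'X^(m.+1) * faber kappa 0 = 2%:R *: ('X^m * faber kappa 1).
      by rewrite faber0 faber1 exprSr scaler_nat mulr_natr.
    rewrite phiZ normrM normr_nat; apply: le_trans (ler_wpM2l _ (IHm 1%N)) _ => //.
    by rewrite faber0 faber1 -polyC_natr hornerC hornerX exprSr; lra.
  have -> : 'X^(m.+1) * faber kappa j.+1 =
      'X^m * faber kappa j.+2 + kappa *: ('X^m * faber kappa j).
    by rewrite faberSS exprSr -mul_polyC; ring.
  rewrite phiD phiZ; apply: le_trans (ler_normD _ _) _.
  rewrite normrM (ger0_norm k0).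
  apply: le_trans (lerD (IHm _) (ler_wpM2l k0 (IHm _))) _.
  by rewrite faberSS hornerD hornerN !hornerM hornerX hornerC exprSr; lra.
move=> m; have := main m 0%N.
rewrite faber0 mulr_natr mulr2n phiD -polyC_natr hornerC -mulr2n normrMn.
by rewrite -[`|_| *+ 2]mulr_natr; lra.
Qed.

End Domination.

(** * Error of the exponential and the explicit bounds *)

Section Estimates.
Variable R : realType.

Lemma expmx_entry_diff N (A At : 'M[R]_N.+1) (c rho kappa tau : R) d k l :
  let B := rho^-1 *: (A - c%:M) in let Bt := rho^-1 *: (At - c%:M) in
  0 < rho -> 0 <= kappa -> 1 <= tau ->
  (forall i, (i <= d)%N -> (B ^+ i) k l = (Bt ^+ i) k l) ->
  (forall n i j, `|horner_mx B (faber kappa n) i j| <= 2) ->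
  (forall n i j, `|horner_mx Bt (faber kappa n) i j| <= 2) ->
  `|expmx A k l - expmx At k l| <=
    4 * expR c * tau^-1 ^+ d.+1 * expR (rho * (tau + kappa / tau)).
Proof.
move=> B Bt rho0 k0 tau1 Beq FB FBt.
have tau0 : 0 < tau by apply: lt_le_trans tau1.
set x := tau + kappa / tau; set K := 4 * tau^-1 ^+ d.+1.
pose phi p := (horner_mx B p - horner_mx Bt p) k l.
have phiD p q : phi (p + q) = phi p + phi q.
  by rewrite /phi !rmorphD !mxE; ring.
have phiZ a p : phi (a *: p) = a * phi p.
  by rewrite /phi !horner_mxZ !mxE; ring.
have phi0 i : (i <= d)%N -> phi 'X^i = 0.
  by move=> id; rewrite /phi !rmorphXn /= !horner_mx_X !mxE Beq // subrr.
have K0 : 0 <= K by rewrite mulr_ge0 // exprn_ge0 // invr_ge0 ltW.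
have Fx j : tau ^+ j <= (faber kappa j).[x].
  by rewrite faber_joukowski ?gt_eqF // lerDl exprn_ge0 // divr_ge0 // ltW.
have phiF j : `|phi (faber kappa j)| <= K * (faber kappa j).[x].
  have [jd|jd] := leqP j d.
    rewrite (functional_faber_eq0 _ _ _ phiD phiZ _ phi0 _ jd) normr0 mulr_ge0 //.
    by apply: le_trans (Fx j); rewrite exprn_ge0 // ltW.
  (* For [j > d] and [tau >= 1], [4 = K tau^(d + 1) <= K tau^j <= K F_j(x)]. *)
  apply: (@le_trans _ _ 4).
    rewrite /phi !mxE; apply: le_trans (ler_normB _ _) _.
    by have := FB j k l; have := FBt j k l; lra.
  apply: le_trans (ler_wpM2l K0 (Fx j)); rewrite /K -mulrA ler_peMr // exprVn.
  by rewrite ler_pdivlMl ?exprn_gt0 // mulr1 ler_weXn2l.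
have phiX := functional_monomial_bound _ _ _ phiD phiZ _ _ k0 phiF.
(* Undoing the scaling turns the bound [K x^m] into [K (rho x)^m], which sums to an exponential. *)
have powE (M : 'M[R]_N.+1) m :
    (M - c%:M) ^+ m = rho ^+ m *: (rho^-1 *: (M - c%:M)) ^+ m.
  by rewrite -exprZn scalerA divff ?gt_eqF // scale1r.
have term m : `|exp_entry R N (A - c%:M) k l m - exp_entry R N (At - c%:M) k l m| <=
    K * exp_coeff (rho * x) m.
  rewrite /exp_entry -mulrBr normrM !powE -/B -/Bt.
  rewrite [X in `|X - _|]mxE [X in `|_ - X|]mxE -mulrBr normrM.
  rewrite [`|_^-1|]ger0_norm ?invr_ge0 //
    [`|rho ^+ m|]ger0_norm ?exprn_ge0 ?(ltW rho0) //.
  rewrite /exp_coeff /= exprMn.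
  have := phiX m; rewrite /phi !rmorphXn /= !horner_mx_X !mxE => h.
  rewrite [leRHS](_ : _ = m`!%:R^-1 * (rho ^+ m * (K * x ^+ m))); last by ring.
  by rewrite ler_wpM2l ?invr_ge0 // ler_wpM2l // exprn_ge0 // ltW.
have cvg1 := cvg_norm (cvgB (expmx_entry_shift R N A c k l)
  (expmx_entry_shift R N At c k l)).
have cvg2 : (expR c * K) * series (exp_coeff (rho * x)) n @[n --> \oo] -->
    (expR c * K) * expR (rho * x).
  by apply: cvgMr; exact: is_cvg_series_exp_coeff.
have := ler_cvg_to (cvg1 _ _) cvg2; rewrite /K => h.
rewrite [leRHS](_ : _ = expR c * (4 * tau^-1 ^+ d.+1) * expR (rho * x)); last by ring.
apply: h; near=> n => /=.
rewrite -mulrBr normrM ger0_norm ?expR_ge0 // -mulrA ler_wpM2l ?expR_ge0 //.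
rewrite -[X in `|X|]/(series (exp_entry R N (A - c%:M) k l) n -
  series (exp_entry R N (At - c%:M) k l) n).
rewrite /series /= -sumrB mulr_sumr; apply: le_trans (ler_norm_sum _ _ _) _.
by apply: ler_sum => i _; exact: term.
Unshelve. all: by end_near.
Qed.

(* With [t = delta + 1], the bound [tau^-t e^(rho (tau + kappa / tau))] is
   smallest at [tau = (t + s) / (a + b)], where [s] is the following square
   root; then [rho (tau + kappa / tau) = s]. *)
Definition optimal_exponent (a b t : R) : R := Num.sqrt (t ^+ 2 + a ^+ 2 - b ^+ 2).

Lemma optimal_exponent_sqr (a b t : R) : 0 <= b -> b <= a ->
  optimal_exponent a b t ^+ 2 = t ^+ 2 + a ^+ 2 - b ^+ 2.
Proof. by move=> b0 ba; rewrite sqr_sqrtr //; have := sqr_ge0 t; nra. Qed.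

(** [s^2 - a^2 = t^2 - b^2 > 0]. Together with [b < t] this gives [t + s > a + b], that is,
    [tau > 1]. *)
Lemma optimal_exponent_gt (a b t : R) : 0 <= b -> b <= a -> b < t ->
  a < optimal_exponent a b t.
Proof.
move=> b0 ba bt; rewrite -[ltLHS]ger0_norm ?(le_trans b0) // -sqrtr_sqr ltr_sqrt; nra.
Qed.

(** Since [p = (t + s) / t] and [q = s / t], the right-hand side is the left-hand side times
    [(t + s) / (t + s - (a + b))], a factor at least 1. *)
Lemma ellipse_bound_ge (a b : R) (c : R[i]%C) (d : nat) (t := d.+1%:R : R) :
  0 < a -> 0 <= b -> b <= a -> b < t ->
  4 * expR (complex.Re c) * ((a + b) / (t + optimal_exponent a b t)) ^+ d.+1
    * expR (optimal_exponent a b t)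
  <= ellipse_bound a b c d%:R.
Proof.
move=> a0 b0 ba bt; set s := optimal_exponent a b t.
have s2 : s ^+ 2 = t ^+ 2 + a ^+ 2 - b ^+ 2 by exact: optimal_exponent_sqr.
have s_gt : a < s by exact: optimal_exponent_gt.
have t0 : 0 < t by rewrite ltr0n.
have s0 : 0 < s by lra.
have tE : d%:R + 1 = t by rewrite natr1.
have tN : d.+1%:R = t by [].
clearbody t; have t_neq0 : t != 0 by rewrite gt_eqF.
have pE : p_ellipse a b t = (t + s) / t.
  rewrite /p_ellipse (_ : 1 + (a ^+ 2 - b ^+ 2) / t ^+ 2 = (s / t) ^+ 2).
    by rewrite sqrtr_sqr ger0_norm ?divr_ge0 ?ltW //; field; lra.
  by rewrite expr_div_n s2; field; lra.
have qE : q_ellipse a b t = s / t.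
  rewrite /q_ellipse -/(optimal_exponent a b t) -/s.
  rewrite (_ : a ^+ 2 - b ^+ 2 = (s - t) * (t + s)); last first.
    by rewrite [t + s]addrC -subr_sqr; lra.
  by field; rewrite t_neq0 gt_eqF //; nra.
rewrite /ellipse_bound tE pE qE -[X in _ `^ X]tN powR_mulrn; last first.
  by rewrite !(mulr_ge0, invr_ge0, divr_ge0, expR_ge0) //; lra.
rewrite (_ : (a + b) / t * _ = expR (s / t) * ((a + b) / (t + s))); last by field; lra.
rewrite [in leRHS]exprMn -expRM_natl tN (_ : t * (s / t) = s); last by field; lra.
set E := expR s; set F := _ ^+ d.+1; set K := 4 * expR _.
have EF0 : 0 <= K * F * E.
  rewrite !mulr_ge0 ?expR_ge0 // exprn_ge0 // divr_ge0; lra.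
have -> : K * ((t + s) / t) / ((t + s) / t - (a + b) / t) * (E * F) =
    K * F * E * ((t + s) / (t + s - (a + b))) by field; lra.
rewrite ler_peMr // ler_pdivlMr; lra.
Qed.

(** Equal semi-axes give [p = 2] and [q = 1]. *)
Lemma disk_boundE (a : R) (c : R[i]%C) (d : R) : 0 <= d -> 0 < a -> a < d + 1 ->
  disk_bound a c d = ellipse_bound a a c d.
Proof.
move=> d0 a0 ad; rewrite /disk_bound /ellipse_bound /p_ellipse /q_ellipse.
rewrite subrr mul0r addr0 sqrtr1.
rewrite mul0r addr0.
congr (_ * _ `^ _); first by field; lra.
by field; lra.
Qed.

Lemma interval_boundE (a c d : R) :
  interval_bound a c d = ellipse_bound a 0 c%:C%C d.
Proof.
rewrite /interval_bound /ellipse_bound /p_interval /p_ellipse /q_interval /q_ellipse.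
by rewrite expr0n /= !subr0 addr0 expr_div_n.
Qed.

Lemma closed_disk_elliptic (a : R) (c : R[i]%C) : 0 < a ->
  closed_disk a c = elliptic_region a a c.
Proof.
move=> a0; apply/seteqP; split => z; rewrite /closed_disk /elliptic_region /=
  normc_def lecR !raddfB /=
  !expr_div_n -mulrDl ler_pdivrMr ?exprn_gt0 // mul1r.
- by move=> h; rewrite -[leLHS]sqr_sqrtr ?addr_ge0 ?sqr_ge0 // ler_pXn2r //
    nnegrE ?sqrtr_ge0 ?(ltW a0).
- by move=> h; rewrite -[leRHS]gtr0_norm // -sqrtr_sqr ler_wsqrtr.
Qed.

Lemma real_interval_elliptic (a b c : R) : 0 < a -> 0 < b ->
  real_interval (c - a) (c + a) `<=` elliptic_region a b c%:C%C.
Proof.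
move=> a0 b0 _ [t t_in <-]; rewrite /elliptic_region /= subr0 mul0r expr0n addr0.
move: t_in; rewrite /= in_itv /= => /andP[t1 t2].
rewrite expr_div_n ler_pdivrMr ?exprn_gt0 // mul1r.
by rewrite -subr_ge0 subr_sqr mulr_ge0 //; lra.
Qed.

End Estimates.

(** * Bounds for the modified graph *)

Section Perturbation.
Variables (R : realType) (N : nat) (G Gt : wdigraph R N.+1).
Variables (dE : {set 'I_N.+1 * 'I_N.+1}) (k l : 'I_N.+1).
Hypothesis hmod : modified_within G Gt dE.

Local Notation A := (adjacency G).
Local Notation At := (adjacency Gt).
Local Notation delta :=
  (dist_to_set G k (sources dE) + dist_from_set G (targets dE) l)%E.

Lemma adjacency_shift_supported (H : wdigraph R N.+1) (r c : R) :
  edge_supported R N.+1 (r *: (adjacency H - c%:M)) H.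
Proof.
move=> u v; rewrite !mxE mulf_eq0 negb_or => /andP[_].
have [->|uv] := eqVneq u v; first by left.
by rewrite subr0; case: ifP => [|_]; [right|rewrite eqxx].
Qed.

Lemma adjacency_modified u v : (u, v) \notin dE -> A u v = At u v.
Proof.
by move=> /hmod[e w]; rewrite !mxE -e; case: ifP => // uv; exact: w.
Qed.

Lemma shift_power_modified (r c : R) i : ((i%:R)%:E <= delta)%E ->
  ((r *: (A - c%:M)) ^+ i) k l = ((r *: (At - c%:M)) ^+ i) k l.
Proof.
apply: (exprmx_modified _ _ _ _ G Gt dE) => // [||u v uv].
- exact: adjacency_shift_supported.
- exact: adjacency_shift_supported.
- by rewrite !mxE; have := adjacency_modified u v uv; rewrite !mxE => ->.
Qed.

(** All powers have equal [(k, l)] entries, so the two exponential series agree term by term. *)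
Lemma expmx_entry_infinite : delta = +oo%E -> expmx A k l = expmx At k l.
Proof.
move=> delta_oo.
have := expmx_entry R N At k l.
rewrite (_ : series _ = series (exp_entry R N A k l)); last first.
  congr series; apply/funext => i; rewrite /exp_entry; congr (_ * _).
  have := shift_power_modified 1 0 i; rewrite delta_oo leey => /(_ isT).
  by rewrite !scale1r raddf0 !subr0.
by apply: (cvg_unique _ (expmx_entry R N A k l)); exact: norm_hausdorff.
Qed.

Lemma ellipse_estimate (a b : R) (c : R[i]%C) d (t := d.+1%:R : R) : 0 < b -> b <= a ->
  field_of_values (complexify A) `<=` elliptic_region a b c ->
  field_of_values (complexify At) `<=` elliptic_region a b c ->
  delta = (d%:R)%:E -> b < t ->
  `|expmx A k l - expmx At k l| <=
    4 * expR (complex.Re c) * ((a + b) / (t + optimal_exponent R a b t)) ^+ d.+1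
      * expR (optimal_exponent R a b t).
Proof.
move=> b0 ba FA FAt delta_d bt; set s := optimal_exponent R a b t.
have a0 : 0 < a by apply: lt_le_trans ba.
have ab0 : 0 < a + b by rewrite addr_gt0.
have s2 : s ^+ 2 = t ^+ 2 + a ^+ 2 - b ^+ 2 by apply: optimal_exponent_sqr; rewrite // ltW.
have s_gt : a < s by apply: optimal_exponent_gt; rewrite // ltW.
clearbody t.
pose kappa := (a - b) / (a + b).
have k0 : 0 <= kappa by rewrite divr_ge0 ?subr_ge0 // ltW.
have k1 : kappa < 1 by rewrite ltr_pdivrMr //; lra.
pose tau := (t + s) / (a + b).
have tau1 : 1 <= tau by rewrite ler_pdivlMr //; lra.
have rho0 : 0 < (a + b) / 2 by rewrite divr_gt0.
have pos M := elliptic_positivity R N M a b _ b0 ba.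
have := expmx_entry_diff _ _ A At (complex.Re c) _ _ _ d k l rho0 k0 tau1 _
  (faber_entry_bound _ _ _ _ k0 k1 (pos _ _ (elliptic_center_real _ _ _ _ _ _ a0 b0 FA)))
  (faber_entry_bound _ _ _ _ k0 k1 (pos _ _ (elliptic_center_real _ _ _ _ _ _ a0 b0 FAt))).
(* Here [rho tau = (t + s) / 2], and [a^2 - b^2 = s^2 - t^2] gives
   [rho kappa / tau = (s - t) / 2]. *)
have -> : (a + b) / 2 * (tau + kappa / tau) = s.
  rewrite /tau /kappa (_ : a - b = (s - t) * (t + s) / (a + b)).
    by field; rewrite !gt_eqF //; lra.
  rewrite [t + s]addrC -subr_sqr (_ : s ^+ 2 - t ^+ 2 = (a - b) * (a + b)).
    by field; lra.
  by rewrite -subr_sqr; lra.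
have -> : tau^-1 = (a + b) / (t + s) by rewrite /tau invf_div.
by apply=> i id; apply: shift_power_modified; rewrite delta_d lee_fin ler_nat.
Qed.

Lemma ellipse_estimate_bound (a b : R) (c : R[i]%C) : b <= a -> 0 < b ->
  field_of_values (complexify A) `<=` elliptic_region a b c ->
  field_of_values (complexify At) `<=` elliptic_region a b c ->
  ((b - 1)%:E < delta)%E ->
  `|expmx A k l - expmx At k l| <= bound_at (ellipse_bound a b c) delta.
Proof.
move=> ba b0 FA FAt.
have [delta_oo|[d delta_d]] := dist_sets_infty_or_nat _ _ G k l (sources dE) (targets dE).
  by move=> _; rewrite expmx_entry_infinite // subrr normr0 delta_oo.
rewrite delta_d lte_fin ltrBlDr natr1 => bt.
apply: le_trans (ellipse_estimate _ _ _ _ b0 ba FA FAt delta_d bt) _.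
by apply: ellipse_bound_ge => //; [exact: lt_le_trans ba|exact: ltW].
Qed.

(* A real interval is a degenerate ellipse, contained in the ellipses with the
   same major axis: let the minor axis tend to 0 in the estimate. *)
Lemma interval_estimate_bound (a c : R) : 0 < a ->
  field_of_values (complexify A) `<=` real_interval (c - a) (c + a) ->
  field_of_values (complexify At) `<=` real_interval (c - a) (c + a) ->
  `|expmx A k l - expmx At k l| <= bound_at (interval_bound a c) delta.
Proof.
move=> a0 FA FAt.
have [delta_oo|[d delta_d]] := dist_sets_infty_or_nat _ _ G k l (sources dE) (targets dE).
  by rewrite expmx_entry_infinite // subrr normr0 delta_oo.
rewrite delta_d /= interval_boundE.
have t0 : 0 < d.+1%:R :> R by rewrite ltr0n.
(* The explicit bound at [b = 0] is first replaced by the smaller estimate, which is continuous in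
   [b] there. *)
apply: le_trans (ellipse_bound_ge _ a 0 _ d a0 _ _ t0); [|by []|exact: ltW].
set t := d.+1%:R.
have exponent_cvg :
    optimal_exponent R a b t @[b --> (0 : R)] --> optimal_exponent R a 0 t.
  rewrite /optimal_exponent.
  apply: (@continuous_cvg _ R R _ _ (fun b => t ^+ 2 + a ^+ 2 - b ^+ 2) Num.sqrt _).
    exact: sqrt_continuous.
  by apply: cvgB; [exact: cvg_cst|exact: exprn_continuous].
have den0 : t + optimal_exponent R a 0 t != 0.
  by rewrite gt_eqF // addr_gt0 // (lt_trans a0) // optimal_exponent_gt // ltW.
have bound_cvg :
    4 * expR c * ((a + b) / (t + optimal_exponent R a b t)) ^+ d.+1
      * expR (optimal_exponent R a b t) @[b --> (0 : R)^'+] -->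
    4 * expR c * ((a + 0) / (t + optimal_exponent R a 0 t)) ^+ d.+1
      * expR (optimal_exponent R a 0 t).
  apply: cvg_at_right_filter; apply: cvgM; last first.
    by apply: continuous_cvg exponent_cvg; exact: continuous_expR.
  apply: cvgM; first exact: cvg_cst.
  apply: (@continuous_cvg _ R R _ _ (fun b => (a + b) / (t + optimal_exponent R a b t))
    (fun x => x ^+ d.+1) _); first exact: exprn_continuous.
  apply: cvgM; first by apply: cvgD; [exact: cvg_cst|exact: cvg_id].
  by apply: cvgV => //; apply: cvgD exponent_cvg; exact: cvg_cst.
apply: (cvgr_to_ge bound_cvg); near=> b.
have b0 : 0 < b by near: b; exact: nbhs_right_gt.
apply: (ellipse_estimate a b (c%:C%C)) => //.
- by near: b; exact: nbhs_right_le.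
- by move=> z /FA; exact: real_interval_elliptic.
- by move=> z /FAt; exact: real_interval_elliptic.
Unshelve. all: by end_near.
Qed.

End Perturbation.

Theorem corollary5p4 (R : realType) (N : nat) (G Gt : wdigraph R N)
  (dE : {set 'I_N * 'I_N}) (hmod : modified_within G Gt dE)
  (k l : 'I_N) (Omega : set (R[i]%C))
  (hF : field_of_values (complexify (adjacency G)) `<=` Omega)
  (hFt : field_of_values (complexify (adjacency Gt)) `<=` Omega) :
  let delta : \bar R :=
    (dist_to_set G k (sources dE) + dist_from_set G (targets dE) l)%E in
  let err : R := `|(expmx (adjacency G) - expmx (adjacency Gt)) k l| in
  (forall (a b : R) (c : R[i]%C), b <= a -> 0 < b ->
     Omega = elliptic_region a b c ->
     ((b - 1)%:E < delta)%E ->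
     err <= bound_at (ellipse_bound a b c) delta) /\
  (forall (a : R) (c : R[i]%C), 0 < a ->
     Omega = closed_disk a c ->
     ((a - 1)%:E < delta)%E ->
     err <= bound_at (disk_bound a c) delta) /\
  (forall (a c : R), 0 < a ->
     Omega = real_interval (c - a) (c + a) ->
     (0%:E < delta)%E ->
     err <= bound_at (interval_bound a c) delta).
Proof.
(* Without vertices there is no [k]; otherwise the size is a successor and the matrices form a
   nontrivial ring. *)
case: N G Gt dE hmod k l hF hFt => [|N] G Gt dE hmod k l hF hFt; first by case: k.
move=> delta err; have -> : err = `|expmx (adjacency G) k l - expmx (adjacency Gt) k l|.
  by rewrite /err !mxE.
split; [|split].
- move=> a b c ba b0 OmegaE; rewrite OmegaE in hF hFt.
  exact: (ellipse_estimate_bound _ _ _ _ dE).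
- move=> a c a0 OmegaE; rewrite OmegaE closed_disk_elliptic // in hF hFt => ad.
  have := ellipse_estimate_bound _ _ _ _ dE k l hmod a a c (lexx a) a0 hF hFt ad.
  (* At infinite distance both bounds read 0; at a finite one the disk bound is the ellipse bound
     with [a = b]. *)
  have [d_oo|[d d_d]] := dist_sets_infty_or_nat _ _ G k l (sources dE) (targets dE).
    by rewrite /delta d_oo.
  move: ad; rewrite /delta d_d /= lte_fin ltrBlDr => ad.
  by rewrite disk_boundE.
- move=> a c a0 OmegaE _; rewrite OmegaE in hF hFt.
  exact: (interval_estimate_bound _ _ _ _ dE).
Qed.
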